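(* Let $\mathbb{K}$ be a field of characteristic zero, let $P(t)\in\mathbb{K}[t]$ have degree $n\ge 1$, and let $Q_1(t),\dots,Q_r(t)\in\mathbb{K}[t]$ be polynomials of degree at most $n$, not all of which are scalar multiples of $P$. Let $\Phi=\{\phi_0,\dots,\phi_{n-1}\}$ be a basis of the space of polynomials of degree at most $n-1$. Suppose that the monic greatest common divisor is $\gcd(P,Q_1,\ldots,Q_r)=t^k+d_1t^{k-1}+\cdots+d_k$. Let $\mathbf{N}^\Phi$ be an $n\times k$ matrix over $\mathbb{K}$ whose columns form a basis of the null space of $\mathbf{B}^P_\Phi(Q_1,\ldots,Q_r)$, and let $\mathbf{Z}^\Phi$ be the matrix formed by the first $k+1$ rows of $\mathbf{P}^{T}_{\mathrm{St}\to\Phi}\,\mathbf{N}^\Phi$. Then $$(d_k,\ldots,d_1,1)\,\mathbf{Z}^\Phi=(0,\ldots,0).$$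
   Context: Bezout matrix: for polynomials $P,Q\in\mathbb{K}[t]$ with $n=\max\{\deg P,\deg Q\}$, the Cayley quotient is $C_{P,Q}(t,x)=\frac{P(t)Q(x)-P(x)Q(t)}{t-x}$, a bivariate polynomial of degree at most $n-1$ in each variable. Given a basis $\Phi=\{\phi_0,\dots,\phi_{n-1}\}$ of the space of polynomials of degree at most $n-1$, write uniquely $C_{P,Q}(t,x)=\sum_{i,j=0}^{n-1} b_{ij}\,\phi_i(t)\phi_j(x)$; the symmetric $n\times n$ matrix $\mathrm{Bez}_\Phi(P,Q)=(b_{ij})$ is the Bezout matrix of $P,Q$ in the basis $\Phi$. $\mathbf{B}^P_\Phi(Q_1,\ldots,Q_r)$ is the $rn\times n$ matrix obtained by stacking $\mathrm{Bez}_\Phi(P,Q_1),\dots,\mathrm{Bez}_\Phi(P,Q_r)$ vertically, in this order. $\mathrm{St}=\{1,t,\dots,t^{n-1}\}$ is the monomial basis. The transformation matrix $\mathbf{P}_{\mathrm{St}\to\Phi}$ is the invertible $n\times n$ matrix over $\mathbb{K}$ defined by $(\phi_0(t),\ldots,\phi_{n-1}(t))\,\mathbf{P}_{\mathrm{St}\to\Phi}=(1,t,\ldots,t^{n-1})$. The superscript $T$ denotes transpose. *)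

(* Defs.v *)
From mathcomp Require Import all_boot all_algebra.
Set Implicit Arguments.
Unset Strict Implicit.
Unset Printing Implicit Defensive.
Import GRing.Theory.
Local Open Scope ring_scope.

(* Bivariate polynomials K[t, x] are {poly {poly K}}, with t = 'X (outer
   variable) and x = 'Y (inner variable): p(t) is p^:P and p(x) is p%:P. *)

Definition cayley_num (K : fieldType) (P Q : {poly K}) : {poly {poly K}} :=
  P^:P * Q%:P - P%:P * Q^:P.

(* The division is exact: see cayley_quotientK. *)
Definition cayley_quotient (K : fieldType) (P Q : {poly K}) :
    {poly {poly K}} :=
  cayley_num P Q %/ ('X - 'Y).

(* With Phi a basis of {poly_n K} and n = max(deg P, deg Q), the matrix B
   exists and is unique: see is_bezout_mx_exists and is_bezout_mx_inj. *)
Definition is_bezout_mx (K : fieldType) (n : nat) (Phi : n.-tuple {poly_n K})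
    (P Q : {poly K}) (B : 'M[K]_n) : Prop :=
  cayley_quotient P Q =
    \sum_(i < n) \sum_(j < n)
       (B i j)%:P%:P * ((tnth Phi i : {poly K})^:P * (tnth Phi j : {poly K})%:P).

Definition is_St_to_basis_mx (K : fieldType) (n : nat)
    (Phi : n.-tuple {poly_n K}) (S : 'M[K]_n) : Prop :=
  (\row_(i < n) (tnth Phi i : {poly K})) *m map_mx polyC S
    = \row_(j < n) ('X^j : {poly K}).

Definition monic_gcd (K : fieldType) (r : nat) (P : {poly K})
    (Q : 'I_r -> {poly K}) : {poly K} :=
  let g := \big[@gcdp K/P]_(i < r) Q i in (lead_coef g)^-1 *: g.

(* mxalgebra works with row spaces, hence the transpositions; unfolded in
   null_space_basisP. *)
Definition null_space_basis (K : fieldType) (m n k : nat) (A : 'M[K]_(m, n))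
    (N : 'M[K]_(n, k)) : Prop :=
  row_free N^T /\ (N^T == kermx A^T)%MS.

(* Padded with zero rows if m > n; see first_rowsE for the case m <= n. *)
Definition first_rows (K : fieldType) (m n k : nat) (A : 'M[K]_(n, k)) :
    'M[K]_(m, k) :=
  \matrix_(i < m, j < k) (if insub (val i) is Some i' then A i' j else 0).
Arguments first_rows {K} m {n k} A.

Lemma first_rowsE (K : fieldType) (m n k : nat) (A : 'M[K]_(n, k))
    (le_mn : (m <= n)%N) :
  first_rows m A = rowsub (widen_ord le_mn) A.
Proof.
apply/matrixP=> i j; rewrite !mxE.
have lt_in := leq_trans (ltn_ord i) le_mn.
by rewrite insubT /=; congr (A _ _); apply: val_inj.
Qed.

Lemma null_space_basisP (K : fieldType) (m n k : nat) (A : 'M[K]_(m, n))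
    (N : 'M[K]_(n, k)) :
  null_space_basis A N <->
  (forall c : 'cV[K]_k, N *m c = 0 -> c = 0) /\
  (forall v : 'cV[K]_n, A *m v = 0 <-> exists c : 'cV[K]_k, v = N *m c).
Proof.
split=> [[freeN /andP[sNA sAN]]|[freeN kerN]].
  split=> [c Nc0|v]; last split.
  - apply: trmx_inj; apply: (row_free_inj freeN).
    by rewrite /= -!trmx_mul Nc0 mulmx0.
  - move=> Av0; have vA : (v^T <= kermx A^T)%MS.
      by apply/sub_kermxP; rewrite -trmx_mul Av0 trmx0.
    have /submxP[c vE] := submx_trans vA sAN.
    by exists c^T; apply: trmx_inj; rewrite trmx_mul trmxK.
  - case=> c ->; apply: trmx_inj; rewrite trmx0 !trmx_mul -mulmxA.
    by rewrite (sub_kermxP sNA) mulmx0.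
split.
  rewrite -kermx_eq0; apply/eqP/row_matrixP=> i; rewrite row0.
  apply: trmx_inj; rewrite trmx0; apply: freeN; apply: trmx_inj.
  by rewrite trmx_mul trmxK trmx0 -row_mul mulmx_ker row0.
apply/andP; split.
  apply/sub_kermxP/row_matrixP=> i; rewrite row_mul row0.
  apply: trmx_inj; rewrite trmx_mul trmxK trmx0; apply/kerN.
  exists (delta_mx i 0); apply: trmx_inj.
  by rewrite trmxK trmx_mul trmx_delta rowE.
apply/row_subP=> i.
have /kerN[c cE] : A *m (row i (kermx A^T))^T = 0.
  by apply: trmx_inj; rewrite trmx_mul trmxK -row_mul mulmx_ker row0 trmx0.
by rewrite -[row i _]trmxK cE trmx_mul submxMl.
Qed.

Section CayleyBezout.

Variable K : fieldType.
Implicit Types P Q : {poly K}.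

Lemma cayley_quotientK P Q :
  cayley_quotient P Q * ('X - 'Y) = cayley_num P Q.
Proof.
have /factor_theorem[C CE] : root (cayley_num P Q) 'X.
  apply/rootP; rewrite /cayley_num hornerD hornerN !hornerM !hornerC.
  by rewrite ![(_^:P).['X]]comp_polyXr subrr.
by rewrite /cayley_quotient CE Pdiv.IdomainMonic.mulpK ?monicXsubC.
Qed.

Lemma swapXY_cayley P Q : swapXY (cayley_quotient P Q) = cayley_quotient P Q.
Proof.
have nz : 'X - 'Y != 0 :> {poly {poly K}} by rewrite polyXsubC_eq0.
apply: (mulIf nz); rewrite cayley_quotientK.
have := congr1 swapXY (cayley_quotientK P Q).
rewrite rmorphM /= rmorphB /= swapXY_X swapXY_Y -opprB mulrN.
move/eqP; rewrite eqr_oppLR => /eqP ->.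
rewrite /cayley_num rmorphB !rmorphM /= !swapXY_map_polyC !swapXY_polyC opprB.
by rewrite mulrC [Q%:P * _]mulrC.
Qed.


Lemma size_cayley (n : nat) P Q : (size P <= n.+1)%N -> (size Q <= n.+1)%N ->
  (size (cayley_quotient P Q) <= n)%N.
Proof.
move=> sP sQ; have [->|nz] := eqVneq (cayley_quotient P Q) 0.
  by rewrite size_poly0.
have := size_Mmonic nz (monicXsubC ('X : {poly K})).
rewrite cayley_quotientK size_XsubC addn2 /= => szC; rewrite -ltnS -szC.
have le_C (p : {poly K}) (u : {poly {poly K}}) :
    (size (p%:P * u)%R <= size u)%N.
  by rewrite mul_polyC size_scale_leq.
rewrite /cayley_num (leq_trans (size_polyD _ _)) // geq_max size_polyN.
rewrite [P^:P * _]mulrC !(leq_trans (le_C _ _)) //.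
  by rewrite size_map_polyC.
by rewrite size_map_polyC.
Qed.

Section Basis.

Variables (n : nat) (Phi : n.-tuple {poly_n K}).
Hypothesis basisPhi : basis_of fullv Phi.

Let F : 'M[K]_n := \matrix_(i, k) (tnth Phi i : {poly K})`_k.

Let basis_sum (u : {poly_n K}) :
  (u : {poly K}) = \sum_(i < n) coord Phi i u *: (tnth Phi i : {poly K}).
Proof.
rewrite {1}(coord_basis basisPhi (memvf u)) !raddf_sum /=.
by apply: eq_bigr => i _; rewrite -tnth_nth.
Qed.

Lemma is_St_to_basis_mxE (S : 'M[K]_n) :
  is_St_to_basis_mx Phi S <-> F^T *m S = 1%:M.
Proof.
split=> [SE|FS].
  apply/matrixP=> k j; rewrite !mxE.
  have /(congr1 (fun M : 'rV[{poly K}]_n => (M 0 j)`_k)) := SE.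
  rewrite !mxE coef_sum coefXn => <-.
  by apply: eq_bigr => i _; rewrite !mxE coefMC.
apply/rowP=> j; rewrite !mxE; apply/polyP=> k; rewrite coef_sum coefXn.
have -> : (\sum_(i < n)
    ((\row_(i0 < n) (tnth Phi i0 : {poly K})) 0 i * map_mx polyC S i j)`_k)
    = \sum_(i < n) (tnth Phi i : {poly K})`_k * S i j.
  by apply: eq_bigr => i _; rewrite !mxE coefMC.
have [lt_kn|le_nk] := ltnP k n.
  have /matrixP/(_ (Ordinal lt_kn) j) := FS; rewrite !mxE => <-.
  by apply: eq_bigr => i _; rewrite !mxE.
rewrite gtn_eqF ?(leq_trans (ltn_ord j)) // big1 // => i _.
by rewrite big_coef_npoly // mul0r.
Qed.

Lemma is_St_to_basis_mx_exists :
  exists2 S : 'M[K]_n, is_St_to_basis_mx Phi S & S \in unitmx.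
Proof.
pose S := \matrix_(i < n, j < n) coord Phi i (npolyp n 'X^j).
have SE : is_St_to_basis_mx Phi S.
  apply/rowP=> j; rewrite !mxE.
  have -> : 'X^j = npolyp n 'X^j :> {poly K}.
    by rewrite npolypK // size_polyXn ltn_ord.
  rewrite [RHS]basis_sum; apply: eq_bigr => i _.
  by rewrite !mxE mulrC mul_polyC.
exists S => //; have /is_St_to_basis_mxE/mulmx1_unit[] // := SE.
Qed.

Lemma is_St_to_basis_mx_inj (S S' : 'M[K]_n) :
  is_St_to_basis_mx Phi S -> is_St_to_basis_mx Phi S' -> S = S'.
Proof.
move=> /is_St_to_basis_mxE FS /is_St_to_basis_mxE FS'.
have [uF _] := mulmx1_unit FS.
by rewrite -(mulKmx uF S) FS -FS' mulKmx.
Qed.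

Lemma is_bezout_mxE P Q (B : 'M[K]_n) :
  (size P <= n.+1)%N -> (size Q <= n.+1)%N ->
  is_bezout_mx Phi P Q B <->
    F^T *m B *m F = \matrix_(k < n, l < n) (cayley_quotient P Q)`_k`_l.
Proof.
move=> sP sQ; set C := cayley_quotient P Q.
have sumE k l : (\sum_(i < n) \sum_(j < n) (B i j)%:P%:P *
      ((tnth Phi i : {poly K})^:P * (tnth Phi j : {poly K})%:P))`_k`_l
    = \sum_(j < n) (\sum_(i < n) (tnth Phi i : {poly K})`_k * B i j)
        * (tnth Phi j : {poly K})`_l.
  rewrite [RHS](eq_bigr _ (fun j _ => mulr_suml _ _ _ _)) exchange_big /=.
  rewrite !coef_sum; apply: eq_bigr => i _.
  rewrite !coef_sum; apply: eq_bigr => j _.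
  by rewrite coefCM coefMC coef_map /= coefCM coefCM mulrCA mulrA.
have mxE' k l (lk : (k < n)%N) (ll : (l < n)%N) :
    (F^T *m B *m F) (Ordinal lk) (Ordinal ll)
    = \sum_(j < n) (\sum_(i < n) (tnth Phi i : {poly K})`_k * B i j)
        * (tnth Phi j : {poly K})`_l.
  rewrite mxE; apply: eq_bigr => j _; rewrite !mxE; congr (_ * _).
  by apply: eq_bigr => i _; rewrite !mxE.
split=> [BE|FBF].
  apply/matrixP=> -[k lk] [l ll]; rewrite mxE' -sumE mxE.
  by rewrite /C BE.
apply/polyP=> k; apply/polyP=> l; rewrite sumE -/C.
have [lk|le_nk] := ltnP k n; last first.
  rewrite /C (nth_default 0 (leq_trans (size_cayley sP sQ) le_nk)) coef0.
  rewrite big1 // => j _.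
  by rewrite big1 ?mul0r // => i _; rewrite big_coef_npoly ?mul0r.
have [ll|le_nl] := ltnP l n; last first.
  rewrite /C -swapXY_cayley coef_swapXY.
  rewrite (nth_default 0 (leq_trans (size_cayley sP sQ) le_nl)) coef0.
  by rewrite big1 // => j _; rewrite [X in _ * X]big_coef_npoly ?mulr0.
by rewrite -mxE' FBF mxE.
Qed.

Lemma is_bezout_mx_exists P Q :
  (size P <= n.+1)%N -> (size Q <= n.+1)%N ->
  exists B : 'M[K]_n, is_bezout_mx Phi P Q B.
Proof.
move=> sP sQ; have [S /is_St_to_basis_mxE FS _] := is_St_to_basis_mx_exists.
pose M := \matrix_(k < n, l < n) (cayley_quotient P Q)`_k`_l.
exists (S *m M *m S^T); apply/is_bezout_mxE => //.
have SF : S^T *m F = 1%:M by rewrite -[F]trmxK -trmx_mul FS trmx1.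
by rewrite !mulmxA FS mul1mx -mulmxA SF mulmx1.
Qed.

Lemma is_bezout_mx_inj P Q (B B' : 'M[K]_n) :
  (size P <= n.+1)%N -> (size Q <= n.+1)%N ->
  is_bezout_mx Phi P Q B -> is_bezout_mx Phi P Q B' -> B = B'.
Proof.
move=> sP sQ /(is_bezout_mxE _ sP sQ) BE /(is_bezout_mxE _ sP sQ) BE'.
have [S /is_St_to_basis_mxE FS _] := is_St_to_basis_mx_exists.
have [uFt _] := mulmx1_unit FS; have uF : F \in unitmx by rewrite -unitmx_tr.
apply: (can_inj (mulKmx uFt)); apply: (can_inj (mulmxK uF)).
by rewrite /= BE BE'.
Qed.

End Basis.

End CayleyBezout.

(* Main.v *)
Require Import Defs.
From HB Require Import structures.
From mathcomp Require Import all_boot all_algebra.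
Import GRing.Theory.
Local Open Scope ring_scope.

(** The theorem holds because, for [deg P = n], the rows of the Bezout matrices
    of [P] with [Q_1, ..., Q_r], read as coefficient vectors of residues modulo
    [P], span the ideal [(Q_1, ..., Q_r)] of [K[x] / (P)], which contains the
    gcd of [P] and the [Q_i].

    To see this for one [Q], write [C_i(x)] for the coefficient of [t^i] in the
    Cayley quotient. Comparing coefficients in
    [C(t, x) (t - x) = P(t) Q(x) - P(x) Q(t)] gives, modulo [P], the recurrence
    [C_(i-1) - x C_i = P_i Q] ([cayley_quotient_coef]). At [i = n] it says that
    [Q] is a multiple of [C_(n-1)] by a nonzero scalar; for [i < n] it then says
    that the span of the [C_i] is stable under multiplication by [x]. So the
    span is an ideal containing [Q], and a linear map that vanishes on [(P)]
    and on every [C_i] vanishes on every multiple of [Q]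
    ([linear_cayley_ideal]). By Bezout's identity, such maps go on vanishing
    when gcds are taken ([linear_gcdp_ideal]).

    Now [W = P_(St -> Phi)^T N] consists of vectors killed by all Bezout
    matrices in the monomial basis ([bezout_mx_null_monomial]), so the linear
    map [residue_map P W], sending a polynomial to the product of the
    coefficient row of its residue modulo [P] with [W], vanishes on all the
    [C_i], hence on the monic gcd [g]. As the [Q_i] are not all multiples of
    [P], [g] has degree [k < n] and is its own residue; then the value of
    [residue_map P W] at [g] is the product in the theorem. *)

(** * Linear maps vanishing on the coefficients of a Cayley quotient *)

Lemma cayley_quotient_coef (K : fieldType) (P Q : {poly K}) (i : nat) :
  (if i is j.+1 then (cayley_quotient P Q)`_j else 0)
      - (cayley_quotient P Q)`_i * 'X
    = P`_i *: Q - Q`_i *: P.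
Proof.
have := congr1 (fun u : {poly {poly K}} => u`_i) (cayley_quotientK P Q).
rewrite /cayley_num mulrBr !coefB coefMX !coefMC coefCM !coef_map /=.
by rewrite (mulrC P) !mul_polyC; case: i.
Qed.

(** The symmetry of the Cayley quotient turns the bound on its degree in [t]
    into a bound on its degree in [x]. *)
Lemma size_cayley_quotient_coef (K : fieldType) (n : nat) (P Q : {poly K})
    (i : nat) :
  (size P <= n.+1)%N -> (size Q <= n.+1)%N ->
  (size ((cayley_quotient P Q)`_i)%R <= n)%N.
Proof.
move=> sP sQ; apply/leq_sizeP => j le_nj.
rewrite -swapXY_cayley coef_swapXY.
by rewrite (nth_default 0 (leq_trans (size_cayley sP sQ) le_nj)) coef0.
Qed.

(** By induction on [h], both [h * C_i] and [h * Q] are killed: the recurrence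
    at [n] deduces the second from the first, and the recurrence at [i] lets
    ['X * C_i] be traded for [C_(i-1)], [Q] and [P]. *)
Lemma linear_cayley_ideal (K : fieldType) (V : lmodType K)
    (L : {linear {poly K} -> V}) (n : nat) (P Q : {poly K}) :
  size P = n.+1 -> (size Q <= n.+1)%N ->
  (forall h, L (h * P) = 0) ->
  (forall i, L (cayley_quotient P Q)`_i = 0) ->
  forall h, L (h * Q) = 0.
Proof.
move=> degP degQ LP LC.
have Pn_neq0 : P`_n != 0.
  have -> : P`_n = lead_coef P by rewrite lead_coefE degP.
  by rewrite lead_coef_eq0 -size_poly_eq0 degP.
(* The recurrence at [n], where [C_n = 0] for degree reasons. *)
have QE : Q = (P`_n)^-1 *:
    ((if n is j.+1 then (cayley_quotient P Q)`_j else 0) + Q`_n *: P).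
  have := cayley_quotient_coef K P Q n.
  rewrite (nth_default 0 (size_cayley (n := n) _ degQ)) ?degP // mul0r subr0.
  by move=> ->; rewrite subrK scalerA mulVf // scale1r.
have LhQ h : (forall i, L (h * (cayley_quotient P Q)`_i) = 0) -> L (h * Q) = 0.
  move=> LhC; rewrite QE -scalerAr linearZ /= mulrDr -scalerAr.
  rewrite linearD linearZ /= LP scaler0 addr0.
  by case: (n) => [|j]; rewrite ?mulr0 ?LhC ?linear0 ?scaler0.
suff LhC h : forall i, L (h * (cayley_quotient P Q)`_i) = 0.
  by move=> h; apply: LhQ.
elim/poly_ind: h => [|h c IH] i; first by rewrite mul0r linear0.
rewrite mulrDl mul_polyC linearD linearZ /= LC scaler0 addr0.
rewrite -mulrA ['X * _]mulrC.
have -> : (cayley_quotient P Q)`_i * 'X =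
    (if i is j.+1 then (cayley_quotient P Q)`_j else 0)
      - (P`_i *: Q - Q`_i *: P).
  by rewrite -cayley_quotient_coef subKr.
have LhQ0 := LhQ _ IH.
rewrite !mulrBr -!scalerAr !(linearB L) !(linearZ_LR L) LP LhQ0 !scaler0 !subr0.
by case: i => [|j]; rewrite ?mulr0 ?linear0 ?IH.
Qed.

Lemma linear_gcdp_ideal (K : fieldType) (V : lmodType K)
    (L : {linear {poly K} -> V}) (p q : {poly K}) :
  (forall h, L (h * p) = 0) -> (forall h, L (h * q) = 0) ->
  forall h, L (h * gcdp p q) = 0.
Proof.
move=> Lp Lq h; have [[u v] /= /eqpP[[c1 c2] /= /andP[_ c2_neq0] gE]] :=
  Bezoutp p q.
have -> : gcdp p q = (c2^-1 * c1) *: (u * p + v * q).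
  by rewrite -scalerA gE scalerA mulVf // scale1r.
rewrite -scalerAr linearZ /= mulrDr !mulrA linearD.
by rewrite Lp Lq addr0 scaler0.
Qed.

(** * Degree of the gcd *)

Lemma biggcdp_dvd (K : fieldType) (r : nat) (P : {poly K})
    (Q : 'I_r -> {poly K}) :
  \big[@gcdp K/P]_(i < r) Q i %| P
  /\ forall i, \big[@gcdp K/P]_(i < r) Q i %| Q i.
Proof.
elim: r Q => [|r IH] Q; first by rewrite big_ord0; split=> // -[].
rewrite big_ord_recl; have [gP gQ] := IH (fun i => Q (lift ord0 i)).
split=> [|i]; first exact: dvdp_trans (dvdp_gcdr _ _) gP.
case: (unliftP ord0 i) => [j ->|->]; last exact: dvdp_gcdl.
exact: dvdp_trans (dvdp_gcdr _ _) (gQ j).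
Qed.

Lemma dvdp_multiple (K : fieldType) (P Q : {poly K}) :
  P != 0 -> (size Q <= size P)%N -> P %| Q -> exists c : K, Q = c *: P.
Proof.
move=> P_neq0 leQP; have [->|Q_neq0] := eqVneq Q 0.
  by exists 0; rewrite scale0r.
move=> dvdPQ; have : P %= Q.
  by rewrite -dvdp_size_eqp // eqn_leq leQP dvdp_leq.
case/eqpP=> -[c1 c2] /= /andP[_ c2_neq0] PQ.
by exists (c2^-1 * c1); rewrite -scalerA PQ scalerA mulVf // scale1r.
Qed.

(** A gcd as large as [P] would be associate to [P], which would then divide
    every [Q i]; the bound on the degrees turns that into scalar multiples. *)
Lemma size_monic_gcd_lt (K : fieldType) (r : nat) (P : {poly K})
    (Q : 'I_r -> {poly K}) :
  P != 0 -> (forall i, (size (Q i) <= size P)%N) ->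
  ~ (forall i, exists c : K, Q i = c *: P) ->
  (size (monic_gcd P Q) < size P)%N.
Proof.
move=> P_neq0 degQ not_mult.
have [gP gQ] := biggcdp_dvd K r P Q.
have g_neq0 : \big[@gcdp K/P]_(i < r) Q i != 0.
  by apply: contraNneq P_neq0 => g0; rewrite g0 dvd0p in gP.
rewrite /monic_gcd size_scale ?invr_eq0 ?lead_coef_eq0 //.
rewrite ltn_neqAle dvdp_leq // andbT; apply/negP => eq_size.
case: not_mult => i; apply: dvdp_multiple => //.
by rewrite dvdp_size_eqp // in eq_size; rewrite -(eqp_dvdl _ eq_size).
Qed.

(** * Coefficients of residues modulo P *)

Definition residue_map {K : fieldType} (n k : nat) (P : {poly K})
    (W : 'M[K]_(n, k)) (p : {poly K}) : 'rV[K]_k :=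
  poly_rV (p %% P) *m W.
Arguments residue_map {K n k} P W p.

Lemma residue_map_is_linear (K : fieldType) (n k : nat) (P : {poly K})
    (W : 'M[K]_(n, k)) : linear (residue_map P W).
Proof.
move=> a p q; rewrite /residue_map modpD modpZl linearP /=.
by rewrite mulmxDl scalemxAl.
Qed.

HB.instance Definition _ (K : fieldType) (n k : nat) (P : {poly K})
    (W : 'M[K]_(n, k)) :=
  GRing.isLinear.Build K {poly K} 'rV[K]_k *:%R (residue_map P W)
    (residue_map_is_linear K n k P W).

(** Passing from the basis [Phi] to monomials replaces [B] by [F^T B F], with
    [F] the matrix of coefficients of [Phi], and [F] is inverse to [S^T]. *)
Lemma bezout_mx_null_monomial (K : fieldType) (n k : nat)
    (Phi : n.-tuple {poly_n K}) (P Q : {poly K}) (B S : 'M[K]_n)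
    (N : 'M[K]_(n, k)) :
  (size P <= n.+1)%N -> (size Q <= n.+1)%N ->
  is_bezout_mx Phi P Q B -> is_St_to_basis_mx Phi S -> B *m N = 0 ->
  \matrix_(i < n, j < n) (cayley_quotient P Q)`_i`_j *m (S^T *m N) = 0.
Proof.
move=> degP degQ /(is_bezout_mxE (n := n) Phi B degP degQ) <-.
move=> /is_St_to_basis_mxE FS BN0.
set F := \matrix_(i, j) _ in FS *.
have FSt : F *m S^T = 1%:M.
  by apply: trmx_inj; rewrite trmx_mul trmxK trmx1 mulmx1C.
by rewrite -(mulmxA _ F) (mulmxA F) FSt mul1mx -mulmxA BN0 mulmx0.
Qed.

Lemma residue_map_cayley0 (K : fieldType) (n k : nat) (P Q : {poly K})
    (W : 'M[K]_(n, k)) :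
  size P = n.+1 -> (size Q <= n.+1)%N ->
  \matrix_(i < n, j < n) (cayley_quotient P Q)`_i`_j *m W = 0 ->
  forall i, residue_map P W (cayley_quotient P Q)`_i = 0.
Proof.
move=> degP degQ CW0 i.
have [lt_in|le_ni] := ltnP i n; last first.
  rewrite nth_default ?linear0 // (leq_trans _ le_ni) //.
  by rewrite size_cayley ?degP.
rewrite /residue_map modp_small; last first.
  by rewrite degP ltnS size_cayley_quotient_coef ?degP.
have -> : poly_rV (cayley_quotient P Q)`_i =
    row (Ordinal lt_in) (\matrix_(i < n, j < n) (cayley_quotient P Q)`_i`_j).
  by apply/rowP=> j; rewrite !mxE.
by rewrite -row_mul CW0 row0.
Qed.

(** * The gcd relation *)

Lemma residue_map_first_rows (K : fieldType) (n k m : nat) (P g : {poly K})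
    (W : 'M[K]_(n, k)) :
  (size g < size P)%N -> (size g <= m)%N -> (m <= n)%N ->
  (\row_(j < m) g`_j) *m first_rows m W = residue_map P W g.
Proof.
move=> lt_gP le_gm le_mn; rewrite /residue_map modp_small // first_rowsE.
apply/rowP=> c; rewrite !mxE.
under eq_bigr => j _ do rewrite !mxE.
under [RHS]eq_bigr => j _ do rewrite !mxE.
rewrite [RHS](bigID (fun j : 'I_n => (j < m)%N)) /=.
rewrite [X in _ = _ + X]big1 => [|j]; last first.
  by rewrite -leqNgt => le_mj; rewrite nth_default ?mul0r ?(leq_trans le_gm).
by rewrite addr0 (big_ord_narrow le_mn).
Qed.

Lemma monic_sum_coef (K : fieldType) (k : nat) (d : nat -> K) (j : nat) :
  (j <= k)%N ->
  ('X^k + \sum_(1 <= i < k.+1) d i *: 'X^(k - i) : {poly K})`_j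
    = if (j < k)%N then d (k - j)%N else 1.
Proof.
move=> le_jk; rewrite coefD coefXn coef_sum.
under eq_bigr => i _ do rewrite coefZ coefXn.
have [lt_jk|le_kj] := ltnP j k; last first.
  have -> : j = k by apply/eqP; rewrite eqn_leq le_jk.
  rewrite eqxx big_nat big1 ?addr0 // => i /andP[i_gt0 le_ik].
  by rewrite gtn_eqF ?mulr0 // -subn_gt0 subKn.
rewrite ltn_eqF // add0r (bigD1_seq (k - j)%N) ?iota_uniq //=; last first.
  by rewrite mem_index_iota subn_gt0 lt_jk ltnS leq_subr.
rewrite subKn // eqxx mulr1 big_nat_cond big1 ?addr0 // => i.
case/andP=> /andP[_ le_ik] neq_i; case: eqP => [jE|]; last by rewrite mulr0.
by rewrite jE subKn ?eqxx in neq_i.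
Qed.

Lemma size_monic_sum (K : fieldType) (k : nat) (d : nat -> K) :
  size ('X^k + \sum_(1 <= i < k.+1) d i *: 'X^(k - i) : {poly K}) = k.+1.
Proof.
rewrite size_polyDl size_polyXn // ltnS.
rewrite big_nat (leq_trans (size_sum _ _ _)) //.
apply/bigmax_leqP_seq => i _ /andP[i_gt0 le_ik].
rewrite (leq_trans (size_scale_leq _ _)) // size_polyXn.
by rewrite ltn_subrL i_gt0 (leq_trans i_gt0).
Qed.

Theorem corollary3 (K : fieldType) (charK0 : [pchar K] =i pred0)
    (n r k : nat) (n_gt0 : (0 < n)%N)
    (P : {poly K}) (degP : size P = n.+1)
    (Q : 'I_r -> {poly K}) (degQ : forall i, (size (Q i) <= n.+1)%N)
    (Q_not_all_multiples : ~ (forall i, exists c : K, Q i = c *: P))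
    (Phi : n.-tuple {poly_n K}) (basisPhi : basis_of fullv Phi)
    (d : nat -> K)
    (gcdE : monic_gcd P Q = 'X^k + \sum_(1 <= i < k.+1) d i *: 'X^(k - i))
    (B : 'I_r -> 'M[K]_n) (bezB : forall i, is_bezout_mx Phi P (Q i) (B i))
    (S : 'M[K]_n) (transS : is_St_to_basis_mx Phi S)
    (N : 'M[K]_(n, k)) (kerN : null_space_basis (\mxcol_(i < r) B i) N) :
  (\row_(j < k.+1) (if (j < k)%N then d (k - j)%N else 1))
    *m first_rows k.+1 (S^T *m N) = 0.
Proof.
have P_neq0 : P != 0 by rewrite -size_poly_eq0 degP.
have BN0 i : B i *m N = 0.
  case: kerN => _ /andP[/sub_kermxP NB0 _].
  have /(congr1 (fun A => submxcol A i)) : \mxcol_(i < r) B i *m N = 0.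
    by apply: trmx_inj; rewrite trmx_mul NB0 trmx0.
  by rewrite mxcol_mul mxcolK submxcol0.
set W := S^T *m N.
have LP h : residue_map P W (h * P) = 0.
  by rewrite /residue_map modp_mull linear0 mul0mx.
have LQ i h : residue_map P W (h * Q i) = 0.
  apply: (linear_cayley_ideal _ _ _ n P) => //.
  apply: residue_map_cayley0 => //.
  by apply: bezout_mx_null_monomial (bezB i) transS (BN0 i); rewrite ?degP.
have Lg : residue_map P W (monic_gcd P Q) = 0.
  suff Lgh h : residue_map P W (h * \big[@gcdp K/P]_(i < r) Q i) = 0.
    by rewrite /monic_gcd -mul_polyC.
  elim/big_ind: _ h => // p q; exact: linear_gcdp_ideal.
have lt_gP : (size (monic_gcd P Q) < size P)%N.
  by apply: size_monic_gcd_lt => // i; rewrite degP.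
have size_g : size (monic_gcd P Q) = k.+1 by rewrite gcdE size_monic_sum.
have -> : \row_(j < k.+1) (if (j < k)%N then d (k - j)%N else 1) =
    \row_(j < k.+1) (monic_gcd P Q)`_j.
  by apply/rowP=> j; rewrite !mxE gcdE monic_sum_coef // -ltnS.
rewrite (residue_map_first_rows _ _ _ _ P) ?size_g //.
  by rewrite -size_g.
by rewrite -ltnS -degP -size_g.
Qed.
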